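(* Let $X$ and $Y$ be proper hyperbolic geodesic spaces and let $f\colon X\to Y$ be a large scale Lipschitz function. If $f$ is visual, then $f$ induces a function $$\tilde f\colon X\cup\partial X\to Y\cup\partial Y$$ such that $\tilde f(\partial X)\subset\partial Y$ and $\tilde f$ is continuous at all points of $\partial X$. Conversely, if $f$ induces a function $\tilde f\colon X\cup\partial X\to Y\cup\partial Y$ such that $\tilde f(\partial X)\subset\partial Y$ and $\tilde f$ is continuous at all points of $\partial X$, then $f$ is visual.
   Context: For a metric space $(X,d)$ and $a,x,y\in X$ the Gromov product is $(x,y)_a=\frac12\big(d(x,a)+d(y,a)-d(x,y)\big)$. $X$ is hyperbolic if for some $\delta$ it satisfies $(x,y)_{x_0}\ge \min\{(x,z)_{x_0},(z,y)_{x_0}\}-\delta/4$ for all $x,y,z,x_0\in X$. Proper means that closed balls are compact. The boundary $\partial X$ of a proper hyperbolic geodesic space $X$ with basepoint $a$ is the set of sequences $(x_n)$ in $X$ with $\liminf_{i,j\to\infty}(x_i,x_j)_a=\infty$, modulo $(x_n)\sim(y_n)$ iff $\liminf_{i,j\to\infty}(x_i,y_j)_a=\infty$. For $p\in\partial X$ and $r>0$ let $U(p,r)\subset X\cup\partial X$ consist of those $q\in\partial X$ for which there are sequences with $[(x_n)]=p$, $[(y_n)]=q$, $\liminf_{i,j\to\infty}(x_i,y_j)_a\ge r$, together with those $x\in X$ such that $\liminf_{i\to\infty}(x_i,x)_a\ge r$ for a sequence with $[(x_n)]=p$. The topology on $X\cup\partial X$: points of $X$ have their usual metric neighbourhoods,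 and the sets $U(p,r)$, $r>0$, form a neighbourhood base at $p\in\partial X$. This makes $X\cup\partial X$ a compact space. $f\colon X\to Y$ is large scale Lipschitz if there are $\lambda_1,\mu_1>0$ with $d(f(x),f(y))\le\lambda_1 d(x,y)+\mu_1$ for all $x,y\in X$. A large scale Lipschitz $f$ is visual if, for some (equivalently every) $a\in X$, for all sequences $(x_n),(y_n)$ in $X$, $(x_n,y_n)_a\to\infty$ implies $(f(x_n),f(y_n))_{f(a)}\to\infty$. ''$f$ induces $\tilde f$'' means that $\tilde f(x)=f(x)$ for $x\in X$ and $\tilde f([(x_n)])=[(f(x_n))]$ for $[(x_n)]\in\partial X$. *)

(* Defs.v *)
From HB Require Import structures.
From mathcomp Require Import all_boot all_order all_algebra.
From mathcomp Require Import all_classical all_reals all_analysis.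
From mathcomp Require Import lra.

Set Implicit Arguments.
Unset Strict Implicit.
Unset Printing Implicit Defensive.

Import Order.TTheory GRing.Theory Num.Theory.
Import numFieldNormedType.Exports.

Local Open Scope classical_set_scope.
Local Open Scope ring_scope.

Section MetricNotions.
Context {R : realType} {X : metricType R}.
Implicit Types (a p x y z : X) (u v : nat -> X).

Definition gromov_product a x y : R :=
  (mdist x a + mdist y a - mdist x y) / 2.

(* liminf of (u_i, v_j)_a as i and j tend to infinity independently *)
Definition liminf_gromov a u v : \bar R :=
  limf_einf (fun ij : nat * nat => (gromov_product a (u ij.1) (v ij.2))%:E)
            (filter_prod \oo \oo).

Definition converges_to_infinity a u : Prop := liminf_gromov a u u = +oo%E.

Definition equiv_at_infinity a u v : Prop := liminf_gromov a u v = +oo%E.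

Definition infinity_class a u : set (nat -> X) :=
  [set v | converges_to_infinity a v /\ equiv_at_infinity a u v].

End MetricNotions.

Section SpaceProperties.
Context {R : realType} (X : metricType R).

Definition hyperbolic : Prop :=
  exists delta : R, forall x y z x0 : X,
    Num.min (gromov_product x0 x z) (gromov_product x0 z y) - delta / 4
      <= gromov_product x0 x y.

(* [set y | mdist x y <= r] rather than the library's closed_ball, which is the
   closure of the open ball. *)
Definition proper_space : Prop :=
  forall (x : X) (r : R), compact [set y : X | mdist x y <= r].

Definition geodesic_space : Prop :=
  forall x y : X, exists g : R -> X,
    [/\ g 0 = x, g (mdist x y) = y &
        {in `[0, mdist x y] &, forall s t, mdist (g s) (g t) = `|s - t|}].

End SpaceProperties.

Section Boundary.
Context {R : realType} {X : metricType R}.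

(* The quotient by equiv_at_infinity, realised as the type of the equivalence
   classes.  The relation is transitive only when X is hyperbolic, so that no
   quotient type can be formed for an arbitrary metric space. *)
Definition boundary (a : X) : Type :=
  {C : set (nat -> X) |
    exists2 u, converges_to_infinity a u & C = infinity_class a u}.

Definition boundary_point (a : X) (u : nat -> X)
    (hu : converges_to_infinity a u) : boundary a :=
  exist _ (infinity_class a u) (ex_intro2 _ _ u hu erefl).

Definition represents (a : X) (u : nat -> X) (p : boundary a) : Prop :=
  exists hu : converges_to_infinity a u, boundary_point hu = p.

Inductive bordification (a : X) : Type :=
  | Inner of X
  | Ideal of boundary a.

Definition ideal_set (a : X) : set (bordification a) := range (@Ideal a).

(* usually written U(p, r) *)
Definition ideal_nbhs (a : X) (p : boundary a) (r : R) :
    set (bordification a) :=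
  [set w | match w with
           | Inner x => exists2 u, represents u p &
               (r%:E <= limn_einf (fun i => (gromov_product a (u i) x)%:E))%E
           | Ideal q => exists u v,
               [/\ represents u p, represents v q &
                   (r%:E <= liminf_gromov a u v)%E]
           end].

Definition bordification_nbhs (a : X) (w : bordification a) :
    set_system (bordification a) :=
  match w with
  | Inner x => [set A | nbhs x (@Inner a @^-1` A)]
  | Ideal p => filter_from [set r : R | 0 < r] (ideal_nbhs p)
  end.

HB.instance Definition _ (a : X) := gen_eqMixin (bordification a).
HB.instance Definition _ (a : X) := gen_choiceMixin (bordification a).
HB.instance Definition _ (a : X) :=
  hasNbhs.Build (bordification a) (@bordification_nbhs a).

End Boundary.

Arguments ideal_set {R X} a.

Section Maps.
Context {R : realType} {X Y : metricType R}.
Implicit Type f : X -> Y.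

Definition large_scale_lipschitz f : Prop :=
  exists lambda mu : R, [/\ 0 < lambda, 0 < mu &
    forall x y, mdist (f x) (f y) <= lambda * mdist x y + mu].

Definition visual_at (a : X) f : Prop :=
  forall u v : nat -> X,
    gromov_product a (u n) (v n) @[n --> \oo] --> +oo ->
    gromov_product (f a) (f (u n)) (f (v n)) @[n --> \oo] --> +oo.

(* Any base point does, by visual_at_indep below. *)
Definition visual f : Prop := exists a : X, visual_at a f.

(* In the second clause, the sequence f \o u must itself converge to infinity
   for the class [(f(u_n))] to be a boundary point. *)
Definition induces {a : X} {b : Y} f
    (F : bordification a -> bordification b) : Prop :=
  (forall x : X, F (Inner a x) = Inner b (f x)) /\
  (forall (u : nat -> X) (hu : converges_to_infinity a u),
    exists hfu : converges_to_infinity b (f \o u),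
      F (Ideal (boundary_point hu)) = Ideal (boundary_point hfu)).

End Maps.

Section VisualBasepoint.
Context {R : realType}.

Lemma gromov_product_basepoint (X : metricType R) (a a' x y : X) :
  gromov_product a x y - mdist a a' <= gromov_product a' x y.
Proof.
have := metric_triangle x a' a; have := metric_triangle y a' a.
rewrite (metric_sym a' a) /gromov_product => h1 h2.
by lra.
Qed.

Lemma gromov_product_cvgy_basepoint (X : metricType R) (a a' : X)
    (u v : nat -> X) :
  gromov_product a (u n) (v n) @[n --> \oo] --> +oo ->
  gromov_product a' (u n) (v n) @[n --> \oo] --> +oo.
Proof.
move=> /cvgryPge h; apply/cvgryPge => A.
near=> n; apply: le_trans (gromov_product_basepoint a a' _ _).
by rewrite lerBrDr; near: n; exact: h.
Unshelve. all: by end_near. Qed.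

Lemma visual_at_indep (X Y : metricType R) (f : X -> Y) (a a' : X) :
  visual_at a f -> visual_at a' f.
Proof.
move=> h u v huv; apply: (@gromov_product_cvgy_basepoint _ (f a)).
exact/h/(gromov_product_cvgy_basepoint _ huv).
Qed.

End VisualBasepoint.

(* Main.v *)
Require Import Defs.
From HB Require Import structures.
From mathcomp Require Import all_boot all_order all_algebra.
From mathcomp Require Import all_classical all_reals all_analysis.
From mathcomp Require Import lra.

(** A visual map sends pairs with large Gromov product to pairs with large
    Gromov product, uniformly, so it maps each neighbourhood [U(p, s)] with [s]
    large into [U(F p, r)].

    Conversely, if [f] is not visual there are [u_n], [v_n] with
    [(u_n, v_n)_a] tending to infinity while [(f u_n, f v_n)] stays bounded.
    The points at distance [N] from [a] on the geodesics [[a, u_n]] lie in a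
    compact ball, so after passing to a subsequence [u] converges to infinity,
    and so does the sequence alternating between [u] and [v].  The image under
    [f] of the alternating sequence then converges to infinity as well, a
    contradiction. *)

Set Implicit Arguments.
Unset Strict Implicit.
Unset Printing Implicit Defensive.

Import Order.TTheory GRing.Theory Num.Theory.
Import numFieldNormedType.Exports.

Local Open Scope classical_set_scope.
Local Open Scope ring_scope.

(** * Lower limits along a filter as eventual bounds *)

Section LimfEinf.
Context {R : realType} {I : choiceType} {T : filteredType I}.
Implicit Types (g : T -> R) (F : set_system T).

Lemma near_le_limf_einf g F (r : R) :
  (\forall x \near F, r <= g x) -> (r%:E <= limf_einf (EFin \o g) F)%E.
Proof.
move=> Fr; rewrite limf_einfE.
apply: (@le_trans _ _ (ereal_inf ((EFin \o g) @` [set x | r <= g x]))).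
  by apply: le_ereal_inf_tmp => _ [x /= rx <-]; rewrite lee_fin.
by apply: ereal_sup_ubound; exists [set x | r <= g x].
Qed.

(** The supremum that defines the lower limit need not be attained, so the eventual bound [s] must
    lie strictly below [r]. *)
Lemma limf_einf_ge_near g F (r s : R) : Filter F -> s < r ->
  (r%:E <= limf_einf (EFin \o g) F)%E -> \forall x \near F, s <= g x.
Proof.
move=> FF sr; rewrite limf_einfE => rg.
have : (s%:E < ereal_sup [set ereal_inf ((EFin \o g) @` V) | V in F])%E.
  by apply: lt_le_trans rg; rewrite lte_fin.
move=> /ereal_sup_gt[_ [V FV <-] sV].
apply: filterS FV => x Vx; rewrite -lee_fin; apply: (le_trans (ltW sV)).
by apply: ereal_inf_lbound; exists x.
Qed.

End LimfEinf.

(** * Gromov products, boundary classes and extraction of sequences converging to infinity *)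

Section SequencesAtInfinity.
Context {R : realType} {X : metricType R}.
Implicit Types (a x y : X) (u v w : nat -> X).

Lemma gromov_product_sym a x y : gromov_product a x y = gromov_product a y x.
Proof. by rewrite /gromov_product (metric_sym x y) (addrC (mdist x a)). Qed.

Lemma gromov_product_le_mdistl a x y : gromov_product a x y <= mdist x a.
Proof.
rewrite /gromov_product; have := metric_triangle y x a.
by rewrite (metric_sym y x); lra.
Qed.

Lemma near_prod_ooP (P : nat -> nat -> Prop) :
  (\forall ij \near filter_prod \oo \oo, P ij.1 ij.2) <->
  exists N, forall i j, (N <= i)%N -> (N <= j)%N -> P i j.
Proof.
split=> [[[A B] /= [[n1 _ An1] [n2 _ Bn2]] ABP]|[N HN]].
  exists (maxn n1 n2) => i j; rewrite !geq_max => /andP[n1i _] /andP[_ n2j].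
  by apply: (ABP (i, j)); split; [exact: An1|exact: Bn2].
exists ([set i | (N <= i)%N], [set j | (N <= j)%N]) => /=.
  by split; exists N.
by move=> [i j] [/= Ni Nj]; exact: HN.
Qed.

Lemma equiv_at_infinityP a u v : equiv_at_infinity a u v <->
  forall M : R, exists N, forall i j, (N <= i)%N -> (N <= j)%N ->
    M <= gromov_product a (u i) (v j).
Proof.
split=> [uv M|H].
  apply/(near_prod_ooP (fun i j => M <= gromov_product a (u i) (v j))).
  apply: (@limf_einf_ge_near _ _ _ _ _ (M + 1)); first by lra.
  by rewrite [limf_einf _ _]uv leey.
apply/eqyP => M _.
apply: near_le_limf_einf.
  exact/(near_prod_ooP (fun i j => M <= gromov_product a (u i) (v j)))/H.
Qed.

Lemma converges_to_infinityP a u : converges_to_infinity a u <->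
  forall M : R, exists N, forall i j, (N <= i)%N -> (N <= j)%N ->
    M <= gromov_product a (u i) (u j).
Proof. exact: equiv_at_infinityP. Qed.

Lemma equiv_at_infinity_sym a u v :
  equiv_at_infinity a u v -> equiv_at_infinity a v u.
Proof.
move=> /equiv_at_infinityP uv; apply/equiv_at_infinityP => M.
have [N HN] := uv M; exists N => i j Ni Nj.
by rewrite gromov_product_sym HN.
Qed.

Lemma equiv_at_infinity_trans a u v w : hyperbolic X ->
  equiv_at_infinity a u v -> equiv_at_infinity a v w ->
  equiv_at_infinity a u w.
Proof.
move=> [delta hyp] /equiv_at_infinityP uv /equiv_at_infinityP vw.
apply/equiv_at_infinityP => M.
have [N1 HN1] := uv (M + delta / 4); have [N2 HN2] := vw (M + delta / 4).
exists (maxn N1 N2) => i j; rewrite !geq_max => /andP[N1i N2i] /andP[N1j N2j].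
apply: le_trans (hyp _ _ (v i) _).
by rewrite lerBrDr le_min HN1// HN2.
Qed.

Lemma eq_infinity_class a u v : hyperbolic X -> equiv_at_infinity a u v ->
  infinity_class a u = infinity_class a v.
Proof.
move=> hyp uv; apply/seteqP; split=> w [ww xw]; split=> //.
- exact: equiv_at_infinity_trans (equiv_at_infinity_sym uv) xw.
- exact: equiv_at_infinity_trans uv xw.
Qed.

Lemma eq_boundary_point a u v (hu : converges_to_infinity a u)
    (hv : converges_to_infinity a v) : hyperbolic X ->
  equiv_at_infinity a u v -> boundary_point hu = boundary_point hv.
Proof. by move=> hyp uv; apply/eq_exist/eq_infinity_class. Qed.

(** The sequence [v] belongs to its own class, since [converges_to_infinity a v] is literally
    [equiv_at_infinity a v v]; equality of the classes then puts [v] in the class of [u]. *)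
Lemma boundary_point_inj a u v (hu : converges_to_infinity a u)
    (hv : converges_to_infinity a v) :
  boundary_point hu = boundary_point hv -> equiv_at_infinity a u v.
Proof.
move=> /(congr1 (@proj1_sig _ _)) /= uv.
by have [] : infinity_class a u v by rewrite uv; split.
Qed.

Lemma boundary_pointP a (p : boundary a) :
  exists u, exists hu : converges_to_infinity a u, p = boundary_point hu.
Proof.
case: p => C [u hu CE]; by exists u, hu; apply: eq_exist.
Qed.

(** The path from [x] through [px] and [py] to [y] bounds [mdist x y] by the two distances to [a]
    minus [2 * N - 2]. This is the triangle inequality alone. *)
Lemma geodesic_truncation_gromov_product a x y px py (N : R) :
  mdist px x = mdist x a - N -> mdist py y = mdist y a - N ->
  mdist px py <= 2 -> N - 1 <= gromov_product a x y.
Proof.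
move=> px_x py_y pxy; rewrite /gromov_product.
have := metric_triangle x px y; have := metric_triangle px py y.
by rewrite (metric_sym x px); lra.
Qed.

Lemma geodesic_truncation a x (N : R) : geodesic_space X ->
  0 <= N <= mdist x a ->
  exists p, mdist a p = N /\ mdist p x = mdist x a - N.
Proof.
move=> geo /andP[N0 Nx]; have [g [g0 g1 gE]] := geo a x.
rewrite metric_sym in Nx; exists (g N); split.
  rewrite -g0 gE ?sub0r ?normrN ?ger0_norm//; rewrite in_itv/= ?lexx ?N0//.
  exact: mdist_ge0.
rewrite -{1}g1 gE ?in_itv/= ?lexx ?N0 ?mdist_ge0//.
by rewrite distrC ger0_norm ?subr_ge0// (metric_sym x).
Qed.

(** Compactness gives a cluster point of the image of [W]. If the indices near it did not form a set
    of [W], their complement would, and that complement misses a neighbourhood of the cluster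
    point. *)
Lemma ultra_compact_ball (W : set_system nat) u (K : set X) (e : R) :
  UltraFilter W -> compact K -> W (u @^-1` K) -> 0 < e ->
  exists x, W [set n | mdist x (u n) < e].
Proof.
move=> UW cK WK e0; have [x [_ clx]] := cK (u @ W) _ WK.
exists x; have [//|WC] := in_ultra_setVsetC [set n | mdist x (u n) < e] UW.
have xe : nbhs x [set y | mdist x y < e].
  by rewrite -ballEmdist; exact: nbhsx_ballx.
have [y [/= ny yx]] := clx (~` [set y | mdist x y < e]) _ WC xe.
by [].
Qed.

(* The ultrafilter replaces the usual diagonal extraction. *)
Lemma converges_to_infinity_subseq a u :
  proper_space X -> geodesic_space X ->
  mdist (u n) a @[n --> \oo] --> +oo ->
  exists2 k : nat -> nat, (forall n, (n <= k n)%N) &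
    converges_to_infinity a (u \o k).
Proof.
move=> prop geo /cvgryPge ua.
have [W [UW ooW]] := ultraFilterLemma (eventually_filter : ProperFilter \oo).
have truncations (N : nat) : exists A : set nat, W A /\
    forall m n, A m -> A n -> N%:R - 1 <= gromov_product a (u m) (u n).
  have /choice[p pP] : forall n, exists p, N%:R <= mdist (u n) a ->
      mdist a p = N%:R /\ mdist p (u n) = mdist (u n) a - N%:R.
    move=> n; have [Nn|nN] := leP N%:R (mdist (u n) a).
      by have [|p] := @geodesic_truncation a (u n) N%:R geo;
        [rewrite ler0n Nn|exists p].
    (* Here [u n] is nearer to [a] than [N]: [a] is a placeholder, and the set of indices chosen
       below excludes such [n]. *)
    by exists a.
  have WN : W [set n | N%:R <= mdist (u n) a] by apply/ooW/ua.
  have WK : W (p @^-1` [set y | mdist a y <= N%:R]).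
    by apply: filterS WN => n /pP[+ _] /=; move=> ->.
  have [x Wx] := ultra_compact_ball UW (prop a N%:R) WK ltr01.
  exists ([set n | mdist x (p n) < 1] `&` [set n | N%:R <= mdist (u n) a]).
  split; first exact: filterI.
  move=> m n [/= xm /pP[_ mE]] [/= xn /pP[_ nE]].
  apply: geodesic_truncation_gromov_product mE nE _.
  by have := metric_triangle (p m) x (p n); rewrite (metric_sym (p m) x); lra.
have /choice[A AP] := truncations.
(* Diagonal choice: finitely many sets [A i] and a tail of the integers all belong to [W], so they
   have a common element. *)
have /choice[k kP] : forall n, exists k, (n <= k)%N /\
    forall i, (i <= n)%N -> A i k.
  move=> n.
  have WA : W [set k | forall i : 'I_n.+1, A i k].
    by apply: filter_forall => i; exact: (AP i).1.
  have Wn : W [set k | (n <= k)%N] by apply/ooW; exists n.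
  have [k [nk Ak]] := filter_ex (filterI Wn WA).
  by exists k; split => // i; rewrite -ltnS => ni; exact: (Ak (Ordinal ni)).
exists k; first by move=> n; exact: (kP n).1.
apply/converges_to_infinityP => M.
(* This integer exceeds [M + 1], which absorbs the [- 1] in the bound for truncations. *)
exists (Num.truncn (M + 1)).+1 => i j Ni Nj.
have := (AP (Num.truncn (M + 1)).+1).2 (k i) (k j)
  ((kP i).2 _ Ni) ((kP j).2 _ Nj).
apply: le_trans.
by rewrite lerBrDr ltW// truncnS_gt.
Qed.

Definition alternate u v (n : nat) : X := if odd n then v n./2 else u n./2.

(** Term [i] of the alternating sequence has a large product with [u i./2]. Two uses of
    hyperbolicity then link terms [i] and [j] through [u i./2] and [u j./2]. *)
Lemma converges_to_infinity_alternate a u v : hyperbolic X ->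
  converges_to_infinity a u ->
  gromov_product a (u n) (v n) @[n --> \oo] --> +oo ->
  converges_to_infinity a (alternate u v).
Proof.
move=> [delta hyp] /converges_to_infinityP uu /cvgryPge uv.
apply/converges_to_infinityP => M.
(* Each use of hyperbolicity costs [delta / 4]; the maximum avoids a case distinction on the sign of
   [delta]. *)
pose M' := Num.max (M + delta / 4) (M + delta / 4 + delta / 4).
have [N1 HN1] := uu M'; have [N2 _ HN2] := uv M'.
have close i : ((maxn N1 N2).*2 <= i)%N ->
    (N1 <= i./2)%N /\ M' <= gromov_product a (alternate u v i) (u i./2).
  move=> /half_leq; rewrite doubleK geq_max => /andP[N1i N2i]; split => //.
  rewrite /alternate; case: odd; last exact: HN1.
  by rewrite gromov_product_sym; exact: HN2.
exists (maxn N1 N2).*2 => i j /close[Ni Mi] /close[Nj Mj].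
have := hyp (alternate u v i) (alternate u v j) (u i./2) a.
apply: le_trans; rewrite lerBrDr le_min; apply/andP; split.
  by apply: le_trans Mi; rewrite /M' le_max lexx.
have := hyp (u i./2) (alternate u v j) (u j./2) a; apply: le_trans.
rewrite lerBrDr; apply: (@le_trans _ _ M'); first by rewrite le_max lexx orbT.
by rewrite le_min HN1// (gromov_product_sym _ (u _) (alternate _ _ _)).
Qed.

End SequencesAtInfinity.

(** * Visual maps and their extensions to the boundary *)

Section VisualMaps.
Context {R : realType} {X Y : metricType R} (a : X) (b : Y).
Implicit Types (f : X -> Y) (u v : nat -> X).

(** If no [N] worked for [M], a bad pair for each natural number would form two sequences
    contradicting visuality. Both base points may be changed freely. *)
Lemma visual_uniform f : visual f -> forall M : R, exists N : R,
  forall x y, N <= gromov_product a x y ->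
    M <= gromov_product b (f x) (f y).
Proof.
move=> [a' /(@visual_at_indep _ _ _ _ _ a) vf] M; apply: contrapT => /forallNP bad.
have /choice[xy xyP] : forall n : nat, exists xy : X * X,
    n%:R <= gromov_product a xy.1 xy.2 /\
    gromov_product b (f xy.1) (f xy.2) < M.
  move=> n; have /existsNP[x /existsNP[y /not_implyP[nxy /negP]]] := bad n%:R.
  by rewrite -ltNge; exists (x, y).
have : gromov_product a (xy n).1 (xy n).2 @[n --> \oo] --> +oo.
  apply/cvgryPge => A; near=> n; apply: le_trans (xyP n).1.
  by near: n; exact: nbhs_infty_ger.
move=> /vf/(gromov_product_cvgy_basepoint b)/cvgryPge/(_ M) [n _ /(_ n (leqnn n))].
by rewrite /= leNgt (xyP n).2.
Unshelve. all: by end_near. Qed.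

Lemma visual_equiv_at_infinity f u v : visual f ->
  equiv_at_infinity a u v -> equiv_at_infinity b (f \o u) (f \o v).
Proof.
move=> vf /equiv_at_infinityP uv; apply/equiv_at_infinityP => M.
have [N fN] := visual_uniform vf M; have [n un] := uv N.
by exists n => i j ni nj; apply/fN/un.
Qed.

(** The image class does not depend on the representative, because visual maps preserve equivalence
    at infinity. *)
Lemma visual_boundary_map f : hyperbolic Y -> visual f ->
  exists g : boundary a -> boundary b, forall p u,
    represents u p -> represents (f \o u) (g p).
Proof.
move=> hyp vf; suff /choice[g gP] : forall p : boundary a,
    exists q : boundary b, forall u, represents u p -> represents (f \o u) q.
  by exists g.
move=> p.
have [u [hu ->]] := boundary_pointP p.
exists (boundary_point (visual_equiv_at_infinity vf hu)) => v [hv vu].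
exists (visual_equiv_at_infinity vf hv); apply: eq_boundary_point => //.
exact/visual_equiv_at_infinity/boundary_point_inj/vu.
Qed.

Lemma visual_extension f : hyperbolic Y -> visual f ->
  exists F : bordification a -> bordification b,
    [/\ induces f F, F @` ideal_set a `<=` ideal_set b &
        forall p : boundary a, {for Ideal p, continuous F}].
Proof.
move=> hyp vf; have [g gP] := visual_boundary_map hyp vf.
exists (fun w => match w with Inner x => Inner b (f x)
                            | Ideal p => Ideal (g p) end).
split.
- split=> // u hu; have [|hfu <-] := gP (boundary_point hu) u; first by exists hu.
  by exists hfu.
- by move=> _ [_ [p _ <-] <-]; exists (g p).
- move=> p A [r /= r0 rA].
  have [N fN] := visual_uniform vf r.
  (* The radius must be positive and also strictly above [N], so that a lower limit yields an
     eventual bound by [N]. *)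
  exists (Num.max N 0 + 1) => /=; first by rewrite ltr_wpDl// le_max lexx orbT.
  have Nlt : N < Num.max N 0 + 1.
    by rewrite ltr_pwDr// le_max lexx.
  move=> [x [u up ux]|q [u [v [up vq uv]]]]; apply: rA => /=.
    exists (f \o u); first exact: gP.
    have uxN : \forall i \near \oo, N <= gromov_product a (u i) x.
      exact: limf_einf_ge_near Nlt ux.
    by apply: near_le_limf_einf; apply: filterS uxN => i /fN.
  exists (f \o u), (f \o v); split; [exact: gP|exact: gP|].
  have uvN : \forall ij \near filter_prod \oo \oo,
      N <= gromov_product a (u ij.1) (v ij.2).
    exact: limf_einf_ge_near Nlt uv.
  by apply: near_le_limf_einf; apply: filterS uvN => ij /fN.
Qed.

Lemma induces_visual f (F : bordification a -> bordification b) :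
  proper_space X -> hyperbolic X -> geodesic_space X ->
  induces f F -> visual f.
Proof.
move=> prop hyp geo [_ indF]; exists a => u v uv.
apply: (@gromov_product_cvgy_basepoint _ _ b).
apply: contrapT => /cvgryPge/existsNP[M /= nM].
have /choice[s sP] : forall n, exists s, (n <= s)%N /\
    gromov_product b (f (u s)) (f (v s)) < M.
  move=> n; apply: contrapT => /forallNP ns; apply: nM.
  exists n => // s /= nls; rewrite leNgt; apply/negP => sM.
  by apply: (ns s).
(* Reindexing by any [k] with [n <= k n] preserves divergence, whether or not [k] is monotone. *)
have uvs (k : nat -> nat) : (forall n, (n <= k n)%N) ->
    gromov_product a (u (k n)) (v (k n)) @[n --> \oo] --> +oo.
  move=> kn; apply/cvgryPge => A; move/cvgryPge/(_ A) : uv => [N _ uvN].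
  by exists N => // n /= Nn; apply/uvN/(leq_trans Nn)/kn.
have [|k nk hk] := @converges_to_infinity_subseq _ _ a (u \o s) prop geo.
  have /cvgryPge us := uvs s (fun n => (sP n).1).
  apply/cvgryPge => A; apply: filterS (us A) => n /le_trans; apply.
  exact: gromov_product_le_mdistl.
have hw : converges_to_infinity a (alternate (u \o s \o k) (v \o s \o k)).
  apply: converges_to_infinity_alternate hyp hk _.
  by apply: (uvs (s \o k)) => n; exact: leq_trans (nk n) (sP _).1.
have [hf _] := indF _ hw.
have /converges_to_infinityP/(_ M)[N] := hf.
(* These consecutive terms of the alternating sequence come from [u] and [v] at the same index
   [s (k N)], where the product of the images is below [M]. *)
move=> /(_ N.*2 N.*2.+1); rewrite -addnn leq_addr -addSn leq_addl.
move=> /(_ isT isT).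
rewrite addSn addnn /= /alternate/= odd_double/= uphalf_double doubleK.
by rewrite leNgt (sP _).2.
Qed.

End VisualMaps.

Theorem theorem2p8 (R : realType) (X Y : metricType R) (a : X) (b : Y)
    (X_proper : proper_space X) (X_hyperbolic : hyperbolic X)
    (X_geodesic : geodesic_space X)
    (Y_proper : proper_space Y) (Y_hyperbolic : hyperbolic Y)
    (Y_geodesic : geodesic_space Y)
    (f : X -> Y) (f_lsl : large_scale_lipschitz f) :
  (visual f ->
     exists F : bordification a -> bordification b,
       [/\ induces f F,
           F @` ideal_set a `<=` ideal_set b &
           forall p : boundary a, {for Ideal p, continuous F}]) /\
  ((exists F : bordification a -> bordification b,
       [/\ induces f F,
           F @` ideal_set a `<=` ideal_set b &
           forall p : boundary a, {for Ideal p, continuous F}]) ->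
     visual f).
Proof.
split; first exact: visual_extension.
by move=> [F [indF _ _]]; exact: induces_visual indF.
Qed.
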